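(* Let $n\geqslant 1$, $U\in\mathcal C^\infty(\mathbb R^n)$ and $\gamma>0$, and let $b:\mathbb R^n\times\mathbb R^n\to\mathbb R^n\times\mathbb R^n$ be given by $$b(x,y)=\begin{pmatrix}y\\-\nabla U(x)-\gamma y\end{pmatrix}.$$ 1. If $b$ satisfies $\mathrm{Cont}_R(M,\rho)$ for some $\rho>0$ and some real symmetric positive definite $2n\times 2n$ matrix $M$, then necessarily there exists $\lambda>0$ such that $\nabla^2U(x)\geqslant\lambda I_n$ for all $x\in\mathbb R^n$. 2. If there exist $x,x'\in\mathbb R^n$ and $\lambda,\Lambda>0$ such that $\sqrt\Lambda-\sqrt\lambda\geqslant\gamma$ and $$\nabla^2U(x)=\lambda I_n,\qquad\nabla^2U(x')=\Lambda I_n,$$ then, for all $\rho>0$ and all real symmetric positive definite $2n\times2n$ matrices $M$, $b$ does not satisfy $\mathrm{Cont}_R(M,\rho)$. 3. If there exist $\lambda,\Lambda>0$ such that $\sqrt\Lambda-\sqrt\lambda<\gamma$ and $$\forall x\in\mathbb R^n,\qquad\lambda I_n\leqslant\nabla^2U(x)\leqslant\Lambda I_n,$$ then $b$ satisfies $\mathrm{Cont}_R(M,\rho)$ for some $\rho>0$ and some real symmetric positive definite $2n\times2n$ matrix $M$. 4. More precisely, if $\lambda I_n\leqslant\nabla^2U(x)\leqslant\Lambda I_n$ for all $x\in\mathbb R^n$ holds for some $\lambda,\Lambda>0$ with $\Lambda\leqslant\gamma^2/4$, then $b$ satisfies $\mathrm{Cont}_R(M,\rho)$ with $\rho=\lambda/(3\gamma)$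 and $$M=\begin{pmatrix}I_n&\gamma^{-1}I_n\\\gamma^{-1}I_n&\Lambda^{-1}I_n\end{pmatrix},$$ which satisfies $\frac12\min(1,\Lambda^{-1})I_{2n}\leqslant M\leqslant\frac32\max(1,\Lambda^{-1})I_{2n}$.
   Context: For real square matrices, not necessarily symmetric, $A\leqslant B$ means $u\cdot Au\leqslant u\cdot Bu$ for all vectors $u$. For a smooth map $b:\mathbb R^d\to\mathbb R^d$ with Jacobian matrix $J_b(z)=(\partial_{z_j}b_i(z))_{1\leqslant i,j\leqslant d}$, a real symmetric positive definite $d\times d$ matrix $M$ and $\rho\in\mathbb R$, the condition $\mathrm{Cont}_R(M,\rho)$ means: $MJ_b(z)\leqslant-\rho M$ for all $z\in\mathbb R^d$. Here $d=2n$ and $z=(x,y)$. *)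

(* Defs.v *)
From HB Require Import structures.
From mathcomp Require Import all_boot all_order all_algebra.
From mathcomp Require Import all_classical all_reals all_analysis.
Set Implicit Arguments.
Unset Strict Implicit.
Unset Printing Implicit Defensive.
Import Order.TTheory GRing.Theory Num.Theory.
Import numFieldNormedType.Exports.
Local Open Scope classical_set_scope.
Local Open Scope ring_scope.

(* Points of R^n are row vectors, as required by the library's [jacobian].
   Matrices keep the usual meaning (they act on columns). *)

Section Matrices.
Variables (R : realType) (d : nat).
Implicit Types A B M : 'M[R]_d.

(* u . (A u) *)
Definition qform A (u : 'rV[R]_d) : R := (u *m A *m u^T) 0 0.

(* A and B are not assumed symmetric. *)
Definition loewner_le A B : Prop := forall u, qform A u <= qform B u.

Definition sym_posdef M : Prop :=
  M^T = M /\ forall u, u != 0 -> 0 < qform M u.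

End Matrices.

Notation "A <=L B" := (loewner_le A B) (at level 70, no associativity).

Section Calculus.
Variable R : realType.

Definition partial n (i : 'I_n) (f : 'rV[R]_n -> R) : 'rV[R]_n -> R :=
  'D_(delta_mx 0 i) f.

Fixpoint class_C n (k : nat) (f : 'rV[R]_n -> R) : Prop :=
  match k with
  | 0 => continuous f
  | k'.+1 => (forall x, differentiable f x) /\
             (forall i, class_C k' (partial i f))
  end.

Definition smooth n (f : 'rV[R]_n -> R) : Prop := forall k, class_C k f.

Definition grad n (f : 'rV[R]_n -> R) (x : 'rV[R]_n) : 'rV[R]_n :=
  \row_i partial i f x.

Definition hess n (f : 'rV[R]_n -> R) (x : 'rV[R]_n) : 'M[R]_n :=
  \matrix_(i, j) partial i (partial j f) x.

(* The library's jacobian acts on row vectors from the right, hence the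
   transpose; see [jacE] for the entries. *)
Definition jac d (b : 'rV[R]_d -> 'rV[R]_d) (z : 'rV[R]_d) : 'M[R]_d :=
  (jacobian b z)^T.

Lemma jacE d (b : 'rV[R]_d -> 'rV[R]_d) (z : 'rV[R]_d) (i j : 'I_d) :
  differentiable b z -> jac b z i j = partial j (fun w => b w 0 i) z.
Proof.
move=> db.
have Db : derivable b z (delta_mx 0 j) by exact: diff_derivable.
have := derive_mx Db.
rewrite deriveEjacobian // => /matrixP/(_ 0 i).
by rewrite -rowE /jac /partial !mxE => ->.
Qed.

Definition ContR d (b : 'rV[R]_d -> 'rV[R]_d) (M : 'M[R]_d) (rho : R) : Prop :=
  forall z, (M *m jac b z) <=L (- rho *: M).

(* b(x, y) = (y, - grad U(x) - gamma y), with z = row_mx x y *)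
Definition drift n (U : 'rV[R]_n -> R) (gamma : R) (z : 'rV[R]_(n + n)) :
    'rV[R]_(n + n) :=
  let x := lsubmx z in let y := rsubmx z in
  row_mx y (- grad U x - gamma *: y).

End Calculus.

(* Main.v *)
(* Write K for the Hessian of U, symmetric by Schwarz; the Jacobian of b sends
   (x, y) to (y, - K x - gamma y).
   1. If K v = k v and mu is a root of mu^2 + gamma mu + k, then (v, mu v) is an
      eigenvector of the Jacobian for mu, so real roots satisfy mu <= - rho. The
      smallest eigenvalue k of K is thus at least min(rho^2, gamma^2 / 4).
   2. On span((v, 0), (0, v)) the problem is two-dimensional; testing on
      (v, sqrt lambda v) and (v, - sqrt Lambda v) gives
      sqrt Lambda - sqrt lambda < gamma.
   3-4. For a matrix M of scalar blocks everything reduces to scalar inequalities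
      once |K x|^2 <= (lambda + Lambda) x.Kx - lambda Lambda |x|^2 is known. *)

Require Import Defs.
From HB Require Import structures.
From mathcomp Require Import all_boot all_order all_algebra.
From mathcomp Require Import ring lra.
From mathcomp Require Import all_classical all_reals all_analysis.
Import Order.TTheory GRing.Theory Num.Theory.
Import numFieldNormedType.Exports.
Local Open Scope classical_set_scope.
Local Open Scope ring_scope.

Set Implicit Arguments.
Unset Strict Implicit.
Unset Printing Implicit Defensive.

(** * Derivatives along lines and symmetry of second derivatives *)

Lemma is_derive_line (R : realType) (V W : normedModType R) (f : V -> W)
    (x v : V) (t : R) :
  derivable f (x + t *: v) v ->
  is_derive t 1 (fun s : R => f (x + s *: v)) ('D_v f (x + t *: v)).
Proof.
move=> df.
have E : (fun h : R => h^-1 *: (((fun s : R => f (x + s *: v)) \o shift t) (h *: 1)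
            - f (x + t *: v))) =
         (fun h : R => h^-1 *: ((f \o shift (x + t *: v)) (h *: v)
            - f (x + t *: v))).
  apply: funext => h /=; congr (_ *: (f _ - _)).
  by rewrite /shift/= scalerDl addrCA (_ : h *: 1 = h :> R)//; exact: mulr1.
by apply: DeriveDef; rewrite ?/derivable /derive E.
Qed.

Lemma MVT_line (R : realType) (V : normedModType R) (f : V -> R) (x v : V)
    (h : R) :
  (forall z, derivable f z v) -> 0 < h ->
  exists2 t : R, 0 < t < h &
    f (x + h *: v) - f x = h * 'D_v f (x + t *: v).
Proof.
move=> df h0.
have [t th e] := @MVT R (fun s : R => f (x + s *: v))
   (fun s => 'D_v f (x + s *: v)) 0 h h0
   (fun s _ => is_derive_line (df _))
   (derivable_within_continuous (fun s _ => @ex_derive _ _ _ _ _ _ _ (is_derive_line (df _)))).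
exists t; first by move: th; rewrite in_itv.
by move: e; rewrite scale0r addr0 subr0 mulrC.
Qed.

(** The mean value theorem is used twice: along [u] for the increment [g z = f (z + h *: v) - f z],
    then along [v] for ['D_u f]. *)
Lemma second_difference_MVT (R : realType) (V : normedModType R) (f : V -> R)
    (x u v : V) (h : R) :
  (forall z, derivable f z u) -> (forall z, derivable ('D_u f) z v) -> 0 < h ->
  exists s t : R, [/\ 0 < s < h, 0 < t < h &
    f (x + h *: u + h *: v) - f (x + h *: u) - (f (x + h *: v) - f x)
      = h ^+ 2 * 'D_v ('D_u f) (x + s *: u + t *: v)].
Proof.
move=> df ddf h0.
pose g z := f (z + h *: v) - f z.
have shiftE z : (fun k : R => k^-1 *: (((f \o (+%R^~ (h *: v))) \o shift z) (k *: u)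
     - (f \o (+%R^~ (h *: v))) z)) =
   (fun k : R => k^-1 *: ((f \o shift (z + h *: v)) (k *: u) - f (z + h *: v))).
  by apply: funext => k /=; rewrite /shift/= addrA.
have dg z : is_derive z u g ('D_u f (z + h *: v) - 'D_u f z).
  apply: (@is_deriveB _ _ _ (f \o (+%R^~ (h *: v))) f).
  by apply: DeriveDef; rewrite /derivable /derive shiftE //; exact: df.
  by apply: DeriveDef.
have [s sh es] := MVT_line x (fun z => @ex_derive _ _ _ _ _ _ _ (dg z)) h0.
have [t th et] := MVT_line (x + s *: u) ddf h0.
exists s, t; split=> //.
by rewrite -/(g _) -/(g x) es derive_val et mulrA expr2.
Qed.

(** The second difference of [f] is symmetric in [u] and [v], so the two mixed derivatives take a
    common value at points near [x]; continuity then makes them agree at [x] up to any [e]. *)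
Lemma derive_comm (R : realType) (V : normedModType R) (f : V -> R)
    (x u v : V) :
  (forall z, derivable f z u) -> (forall z, derivable f z v) ->
  (forall z, derivable ('D_u f) z v) -> (forall z, derivable ('D_v f) z u) ->
  {for x, continuous ('D_v ('D_u f))} -> {for x, continuous ('D_u ('D_v f))} ->
  'D_v ('D_u f) x = 'D_u ('D_v f) x.
Proof.
move=> du dv duv dvu cuv cvu.
apply/eqP; rewrite -subr_eq0 -normr_le0; apply/ler_addgt0Pr => e e0; rewrite add0r.
set F := 'D_v ('D_u f) in cuv *; set G := 'D_u ('D_v f) in cvu *.
have e2 : 0 < e / 2 by rewrite divr_gt0.
have /(cvgrPdist_lt F (F x))/(_ _ e2)/nbhs_normP[r1 /= r10 H1] := cuv.
have /(cvgrPdist_lt G (G x))/(_ _ e2)/nbhs_normP[r2 /= r20 H2] := cvu.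
pose r := Num.min r1 r2.
have r0 : 0 < r by rewrite lt_min r10.
(* This keeps the intermediate points of both mean value arguments within [r] of [x]; the [+ 1]
   makes the denominator positive even if [u = v = 0]. *)
pose h := r / (`|u| + `|v| + 1).
have N0 : 0 < `|u| + `|v| + 1 by rewrite ltr_wpDl ?addr_ge0.
have h0 : 0 < h by rewrite divr_gt0.
have near s t w w' : `|w| + `|w'| = `|u| + `|v| -> 0 < s < h -> 0 < t < h ->
    `|x - (x + s *: w + t *: w')| < r.
  move=> ww /andP[s0 sh] /andP[t0 th].
  rewrite -addrA opprD addrA subrr add0r normrN.
  apply: le_lt_trans (ler_normD _ _) _; rewrite !normrZ !gtr0_norm//.
  have -> : r = h * `|w| + h * `|w'| + h.
    by rewrite -mulrDr ww -[X in _ + X]mulr1 -mulrDr /h divfK// gt_eqF.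
  by rewrite -[ltLHS]addr0 ler_ltD// lerD// ler_wpM2r// ltW.
have [s [t [sh th]]] := second_difference_MVT x du duv h0.
have [t' [s' [th' sh']]] := second_difference_MVT x dv dvu h0.
rewrite (addrAC x) -/F -/G => eG eF.
have FG : F (x + s *: u + t *: v) = G (x + t' *: v + s' *: u).
  have cancel (p q : R) : h ^+ 2 * p = h ^+ 2 * q -> p = q.
    by apply: mulfI; rewrite expf_neq0// gt_eqF.
  have swap (a b c d : R) : a - b - (c - d) = a - c - (b - d) by ring.
  apply: cancel.
  apply: (etrans (esym eF)).
  apply: (etrans _ eG).
  exact: swap.
have tri (a b c : R) : `|a - b| < e / 2 -> `|c - b| < e / 2 -> `|a - c| <= e.
  move=> ab cb; rewrite -(subrKA b) [leRHS]splitr.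
  apply: le_trans (ler_normD _ _) _.
  apply: lerD; apply: ltW; first exact: ab.
  by rewrite distrC; exact: cb.
apply: (tri _ (F (x + s *: u + t *: v))).
  by apply: H1; apply: lt_le_trans (near _ _ _ _ erefl sh th) _; rewrite ge_min lexx.
rewrite FG; apply: H2 => /=.
by apply: lt_le_trans (near _ _ _ _ (addrC _ _) th' sh') _; rewrite ge_min lexx orbT.
Qed.

(** * The Hessian of a smooth function and the Jacobian of the drift *)

Lemma smooth_differentiable (R : realType) n (U : 'rV[R]_n -> R) :
  smooth U -> forall x, differentiable U x.
Proof. by move=> /(_ 1)[]. Qed.

Lemma smooth_partial (R : realType) n (U : 'rV[R]_n -> R) (i : 'I_n) :
  smooth U -> smooth (partial i U).
Proof. by move=> sU k; have [_] := sU k.+1; apply. Qed.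

Lemma hess_sym (R : realType) n (U : 'rV[R]_n -> R) (x : 'rV[R]_n) :
  smooth U -> (hess U x)^T = hess U x.
Proof.
move=> sU; apply/matrixP => i j; rewrite !mxE /partial.
have df i' z := smooth_differentiable (smooth_partial i' sU) z.
apply: derive_comm.
- by move=> z; apply/diff_derivable/smooth_differentiable.
- by move=> z; apply/diff_derivable/smooth_differentiable.
- by move=> z; apply/diff_derivable/df.
- by move=> z; apply/diff_derivable/df.
- apply: differentiable_continuous.
  exact/smooth_differentiable/smooth_partial/smooth_partial.
- apply: differentiable_continuous.
  exact/smooth_differentiable/smooth_partial/smooth_partial.
Qed.

Lemma derive_partials (R : realType) n (f : 'rV[R]_n -> R) (x v : 'rV[R]_n) :
  differentiable f x -> 'D_v f x = \sum_j v 0 j * partial j f x.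
Proof.
move=> df; rewrite deriveE// {1}(row_sum_delta v) linear_sum/=.
by apply: eq_bigr => j _; rewrite linearZ/= /partial deriveE.
Qed.

Lemma differentiable_rV (R : realType) (V : normedModType R) n
    (f : V -> 'rV[R]_n) (x : V) :
  (forall k, differentiable (fun z => f z 0 k) x) -> differentiable f x.
Proof.
move=> df.
have -> : f = \sum_(k < n) (fun z => f z 0 k *: (delta_mx 0 k : 'rV[R]_n)).
  by apply: funext => z; rewrite fct_sumE -row_sum_delta.
by apply: differentiable_sum => k; apply: differentiableZl.
Qed.

Lemma derive_lsubmx (R : realType) n m (g : 'rV[R]_n -> R)
    (z u : 'rV[R]_(n + m)) :
  'D_u (fun w => g (lsubmx w)) z = 'D_(lsubmx u) g (lsubmx z).
Proof.
rewrite /derive; set F := (X in X @ _); set G := (X in _ = lim (X @ _)).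
suff -> : F = G by [].
apply: funext => h; rewrite /F /G /= /shift/=; congr (_ *: (g _ - _)).
by apply/rowP => i; rewrite !mxE.
Qed.

Lemma drift_rE (R : realType) n (U : 'rV[R]_n -> R) (gamma : R) (k : 'I_n) :
  (fun w => drift U gamma w 0 (rshift n k)) =
  - (fun w => partial k U (lsubmx w)) - gamma *: (fun w => w 0 (rshift n k)).
Proof. by apply: funext => w; rewrite /drift row_mxEr !mxE. Qed.

Lemma drift_lE (R : realType) n (U : 'rV[R]_n -> R) (gamma : R) (k : 'I_n) :
  (fun w => drift U gamma w 0 (lshift n k)) = (fun w => w 0 (rshift n k)).
Proof. by apply: funext => w; rewrite /drift row_mxEl !mxE. Qed.

Lemma derive_coord (R : realType) n (k : 'I_n) (z u : 'rV[R]_n) :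
  'D_u (fun w : 'rV[R]_n => w 0 k) z = u 0 k.
Proof.
have := @derive_mx R _ 1 n id z u (@derivable_id _ _ _ _).
by rewrite derive_id => /matrixP/(_ 0 k); rewrite mxE.
Qed.

Lemma differentiable_partial_lsubmx (R : realType) n (U : 'rV[R]_n -> R)
    (k : 'I_n) (z : 'rV[R]_(n + n)) :
  smooth U -> differentiable (fun w : 'rV[R]_(n + n) => partial k U (lsubmx w)) z.
Proof.
move=> sU; apply: differentiable_comp; first exact: differentiable_lsubmx.
exact/smooth_differentiable/smooth_partial.
Qed.

Lemma differentiable_drift (R : realType) n (U : 'rV[R]_n -> R) (gamma : R)
    (z : 'rV[R]_(n + n)) :
  smooth U -> differentiable (drift U gamma) z.
Proof.
move=> sU; apply: differentiable_rV => k.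
rewrite -(splitK k); case: (fintype.split k) => {}k /=.
  by rewrite drift_lE; apply: differentiable_coord.
rewrite drift_rE; apply: differentiableB.
  by apply: differentiableN; apply: differentiable_partial_lsubmx.
by apply: differentiableZ; apply: differentiable_coord.
Qed.

(** Each coordinate is a directional derivative of a component of the drift. Entry [(j, k)] of
    [hess] is [partial j (partial k U)], so the row product with [x] differentiates [partial k U]
    along [x]. *)
Lemma mul_jac_drift (R : realType) n (U : 'rV[R]_n -> R) (gamma : R)
    (z : 'rV[R]_(n + n)) (x y : 'rV[R]_n) :
  smooth U ->
  row_mx x y *m (jac (drift U gamma) z)^T =
  row_mx y (- (x *m hess U (lsubmx z)) - gamma *: y).
Proof.
move=> sU; have dd := differentiable_drift gamma z sU.
have der : derivable (drift U gamma) z (row_mx x y) by exact: diff_derivable.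
rewrite /jac trmxK -deriveEjacobian// derive_mx//.
apply/rowP => k; rewrite mxE -(splitK k); case: (fintype.split k) => {}k /=.
  by rewrite drift_lE derive_coord row_mxEl row_mxEr.
have dp := differentiable_partial_lsubmx k z sU.
rewrite drift_rE row_mxEr deriveB; last 2 first.
- by apply/diff_derivable/differentiableN.
- by apply/diff_derivable/differentiableZ/differentiable_coord.
rewrite deriveN; last exact: diff_derivable.
rewrite deriveZ; last exact/diff_derivable/differentiable_coord.
rewrite derive_coord row_mxEr derive_lsubmx row_mxKl derive_partials; last first.
  exact/smooth_differentiable/smooth_partial.
rewrite !mxE; congr (- _ - _).
by apply: eq_bigr => j _; rewrite mxE.
Qed.

(** * Dot product and quadratic forms on row vectors *)

(** Written as the same matrix product as [qform], so that [qformE] holds by conversion. *)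
Definition dot (R : realType) n (u v : 'rV[R]_n) : R := (u *m v^T) 0 0.

Section Dot.
Variables (R : realType) (n : nat).
Implicit Types (u v w : 'rV[R]_n) (A K : 'M[R]_n) (a : R).

Lemma dotE u v : dot u v = \sum_i u 0 i * v 0 i.
Proof. by rewrite /dot mxE; apply: eq_bigr => i _; rewrite mxE. Qed.

Lemma dotC u v : dot u v = dot v u.
Proof. by rewrite !dotE; apply: eq_bigr => i _; rewrite mulrC. Qed.

Lemma dotDl u v w : dot (u + v) w = dot u w + dot v w.
Proof. by rewrite /dot mulmxDl mxE. Qed.

Lemma dotZl a u w : dot (a *: u) w = a * dot u w.
Proof. by rewrite /dot -scalemxAl mxE. Qed.

Lemma dotNl u w : dot (- u) w = - dot u w.
Proof. by rewrite -scaleN1r dotZl mulN1r. Qed.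

Lemma dotDr u v w : dot w (u + v) = dot w u + dot w v.
Proof. by rewrite dotC dotDl !(dotC w). Qed.

Lemma dotZr a u w : dot w (a *: u) = a * dot w u.
Proof. by rewrite dotC dotZl (dotC w). Qed.

Lemma dotNr u w : dot w (- u) = - dot w u.
Proof. by rewrite dotC dotNl (dotC w). Qed.

Definition dot_lin := (dotDl, dotDr, dotNl, dotNr, dotZl, dotZr).

Lemma dot_ge0 u : 0 <= dot u u.
Proof. by rewrite dotE sumr_ge0// => i _; rewrite -expr2 sqr_ge0. Qed.

Lemma dot_eq0 u : (dot u u == 0) = (u == 0).
Proof.
apply/idP/idP => [|/eqP->]; last by rewrite /dot mul0mx mxE.
rewrite dotE psumr_eq0 => [/allP u0|i _]; last by rewrite -expr2 sqr_ge0.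
apply/eqP/rowP => i; rewrite mxE; apply/eqP.
by have := u0 i (mem_index_enum _); rewrite mulf_eq0 orbb.
Qed.

Lemma dot_gt0 u : (0 < dot u u) = (u != 0).
Proof. by rewrite lt0r dot_eq0 dot_ge0 andbT. Qed.

Lemma dot0r u : dot u 0 = 0.
Proof. by rewrite -(scale0r 0) dotZr mul0r. Qed.

Lemma qformE A u : qform A u = dot (u *m A) u.
Proof. by []. Qed.

Lemma qform_scalar a u : qform a%:M u = a * dot u u.
Proof. by rewrite qformE mul_mx_scalar dotZl. Qed.

Lemma dot_mulmxl A u v : dot (u *m A) v = dot u (v *m A^T).
Proof. by rewrite /dot trmx_mul trmxK mulmxA. Qed.

Lemma dot_sym A u v : A^T = A -> dot (u *m A) v = dot (v *m A) u.
Proof. by move=> sA; rewrite dot_mulmxl sA dotC. Qed.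

Lemma exists_rV_neq0 : (0 < n)%N -> exists v : 'rV[R]_n, v != 0.
Proof.
case: n => // n' _; exists (const_mx 1); apply/negP => /eqP/rowP/(_ 0).
by rewrite !mxE; apply/eqP/oner_neq0.
Qed.

(** * Bounds on [x *m K] from scalar bounds on [K] *)

Lemma scalar_loewner_le a b K : (0 < n)%N ->
  a%:M <=L K -> K <=L b%:M -> a <= b.
Proof.
move=> /exists_rV_neq0[v]; rewrite -dot_gt0 => v0 aK Kb.
by have := le_trans (aK v) (Kb v); rewrite !qform_scalar ler_pM2r.
Qed.

(* Expand [0 <= qform S (x - t *: (x *m S))] and take [t = 1 / b]. *)
Lemma sqr_mulmx_le (S : 'M[R]_n) b x : S^T = S -> 0 < b ->
  (0 : R)%:M <=L S -> S <=L b%:M -> dot (x *m S) (x *m S) <= b * dot (x *m S) x.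
Proof.
move=> sS b0 S0 Sb.
set p := x *m S.
have := S0 (x - b^-1 *: p); have := Sb p.
rewrite !qform_scalar mul0r !qformE mulmxBl -scalemxAl -/p.
have -> : dot (p - b^-1 *: (p *m S)) (x - b^-1 *: p) =
  dot p x - 2 * b^-1 * dot p p + b^-1 ^+ 2 * dot (p *m S) p.
  rewrite !dot_lin (dot_sym p x sS) -/p; ring.
move=> h1 h2.
have h3 : b^-1 ^+ 2 * dot (p *m S) p <= b^-1 * dot p p.
  apply: le_trans (ler_wpM2l _ h1) _; first exact: sqr_ge0.
  by rewrite expr2 mulrA mulfVK ?gt_eqF.
rewrite -ler_pdivrMl//; lra.
Qed.

(* Equivalently, [(K - a)(b - K) >= 0]. *)
Lemma sqr_mulmx_le_interval (K : 'M[R]_n) a b x : K^T = K ->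
  a <= b -> a%:M <=L K -> K <=L b%:M ->
  dot (x *m K) (x *m K) <= (a + b) * dot (x *m K) x - a * b * dot x x.
Proof.
move=> sK ab aK Kb; pose S := K - a%:M.
have SE y : y *m S = y *m K - a *: y by rewrite mulmxBr mul_mx_scalar.
have sS : S^T = S by rewrite /S linearB/= sK tr_scalar_mx.
have S0 : (0 : R)%:M <=L S.
  move=> u; rewrite qform_scalar mul0r qformE SE dotDl dotNl dotZl subr_ge0.
  by have := aK u; rewrite qform_scalar.
(* [sqr_mulmx_le] asks for a positive bound while [b - a] may vanish; it is applied with positive
   [c >= b - a], and the excess is made arbitrarily small. *)
have Sb c : b - a <= c -> S <=L c%:M.
  move=> bac u; rewrite qform_scalar qformE SE dotDl dotNl dotZl.
  have := Kb u; rewrite qform_scalar qformE; have := dot_ge0 u; nra.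
have main c : 0 < c -> b - a <= c ->
    dot (x *m S) (x *m S) <= c * dot (x *m S) x.
  by move=> c0 bac; apply: sqr_mulmx_le => //; exact: Sb.
suff : dot (x *m S) (x *m S) <= (b - a) * dot (x *m S) x.
  rewrite !SE !dot_lin (dotC x (x *m K)); lra.
have P0 : 0 <= dot (x *m S) x by have := S0 x; rewrite qform_scalar mul0r.
apply/ler_addgt0Pr => e e0.
pose c := b - a + e / (dot (x *m S) x + 1).
have e1 : 0 < e / (dot (x *m S) x + 1) by rewrite divr_gt0// ltr_wpDl.
have ba : 0 <= b - a by rewrite subr_ge0.
apply: le_trans (main c _ _) _; rewrite ?/c; [exact: ltr_wpDl|by rewrite lerDl ltW|].
rewrite mulrDl lerD2l -mulrA ger_pMr// mulrC ler_pdivrMr ?mul1r ?lerDl//.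
by rewrite ltr_wpDl.
Qed.

(** * The smallest eigenvalue of a symmetric matrix *)

Lemma continuous_qform A : continuous (qform A).
Proof.
have -> : qform A = fun u => \sum_i (\sum_j u 0 j * A j i) * u 0 i.
  apply: funext => u; rewrite qformE dotE; apply: eq_bigr => i _.
  by rewrite mxE.
apply: continuous_big => [|i _]; first exact: add_continuous.
move=> u; apply: continuousM; last exact: coord_continuous.
move: u; apply: continuous_big => [|j _]; first exact: add_continuous.
move=> u; apply: continuousM; [exact: coord_continuous|exact: cst_continuous].
Qed.

(** The sphere is a level set of a continuous form, hence closed. The norm on matrices is the
    maximum of the absolute entries, each at most 1 here. *)
Lemma unit_sphere_compact : compact [set u : 'rV[R]_n | dot u u = 1].
Proof.
have sphereE : [set u : 'rV[R]_n | dot u u = 1] = qform 1%:M @^-1` [set 1].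
  by apply/seteqP; split => u /=; rewrite qform_scalar mul1r.
apply: bounded_closed_compact.
  exists 1; split=> // c c1 u /= u1; apply: le_trans (ltW c1).
  rewrite [leLHS]/Num.Def.normr/= mx_normrE bigmax_le// => -[i j] _ /=.
  rewrite ord1 -(expr_le1 (n := 2))// real_normK ?num_real// -u1 dotE.
  by rewrite (bigD1 j)//= -expr2 lerDl sumr_ge0// => k _; rewrite -expr2 sqr_ge0.
rewrite sphereE; move/continuous_closedP: (@continuous_qform 1%:M); apply.
exact: closed_eq.
Qed.

Lemma qform_homog A a u : qform A (a *: u) = a ^+ 2 * qform A u.
Proof. by rewrite !qformE -scalemxAl dotZl dotZr mulrA. Qed.

Lemma dot_homog a u : dot (a *: u) (a *: u) = a ^+ 2 * dot u u.
Proof. by rewrite dotZl dotZr mulrA. Qed.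

(* The minimiser of [qform K] on the unit sphere. *)
Lemma min_eigenvector K : (0 < n)%N -> K^T = K ->
  exists k v, [/\ v != 0, v *m K = k *: v & k%:M <=L K].
Proof.
move=> /exists_rV_neq0[v0 v00] sK.
have normalize u : u != 0 ->
    let c := (Num.sqrt (dot u u))^-1 in dot (c *: u) (c *: u) = 1.
  rewrite -dot_gt0 => u0 c; rewrite dot_homog exprVn sqr_sqrtr ?ltW//.
  by rewrite mulVf// gt_eqF.
have [] := @EVT_min_rV R n (qform K) [set u | dot u u = 1].
- by eexists; exact: normalize v00.
- exact: unit_sphere_compact.
- exact/continuous_subspaceT/continuous_qform.
move=> v; rewrite inE/= => v1 minv.
have kK : (qform K v)%:M <=L K.
  move=> u; rewrite qform_scalar.
  have [->|u0] := eqVneq u 0; first by rewrite !qformE !dot0r mulr0.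
  have := minv _ (mem_set (normalize u u0)); rewrite qform_homog exprVn.
  rewrite sqr_sqrtr ?dot_ge0// ler_pdivlMl ?dot_gt0//.
  by rewrite mulrC.
have [k kE] : exists k, qform K v = k by exists (qform K v).
rewrite kE in kK; exists k, v; split=> //.
  by rewrite -dot_gt0 v1.
(* [w] is the component of [v *m K] orthogonal to [v]; minimality forces it to vanish. *)
have [w vK] : exists w, v *m K = w + k *: v.
  by exists (v *m K - k *: v); rewrite subrK.
suff w0 : w = 0 by rewrite vK w0 add0r.
have wv : dot w v = 0.
  by apply: (addIr k); rewrite add0r -[RHS]kE qformE vK dotDl dotZl v1 mulr1.
have wKv : dot (w *m K) v = dot w w.
  by rewrite (dot_sym w v sK) vK dotDl dotZl (dotC v) wv mulr0 addr0.
(* First-order optimality along [v - t *: w]. *)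
have opt t : 0 <= t ^+ 2 * (qform K w - k * dot w w) - 2 * t * dot w w.
  have := kK (v - t *: w); rewrite qform_scalar -subr_ge0 !qformE.
  rewrite mulmxBl -scalemxAl !dot_lin wKv vK !dot_lin (dotC v w) wv v1.
  by congr (0 <= _); ring.
apply/eqP; rewrite -dot_eq0 eq_le dot_ge0 andbT leNgt; apply/negP => w0.
have q0 : 0 <= qform K w - k * dot w w.
  by rewrite subr_ge0 -qform_scalar kK.
set q := qform K w - k * dot w w in opt q0.
have q1 : 0 < q + 1 by rewrite ltr_wpDl.
(* For [t = dot w w / (q + 1)], [opt] would read [0 <= - t ^+ 2 * (q + 2)], impossible for
   [t > 0]. *)
have := opt (dot w w / (q + 1)); rewrite leNgt => /negP; apply.
rewrite (_ : _ - _ = - (dot w w / (q + 1)) ^+ 2 * (q + 2)); last first.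
  by field; rewrite gt_eqF.
by rewrite mulNr oppr_lt0 mulr_gt0 ?exprn_gt0 ?divr_gt0// ltr_wpDl.
Qed.

End Dot.

(** * The contraction condition for the drift, and its links with bounds on the Hessian *)

Section DriftForm.
Variables (R : realType) (n : nat).
Implicit Types (x y v : 'rV[R]_n) (U : 'rV[R]_n -> R) (M : 'M[R]_(n + n)).

Lemma dot_row_mx x y x' y' :
  dot (row_mx x y) (row_mx x' y') = dot x x' + dot y y'.
Proof. by rewrite /dot tr_row_mx mul_row_col mxE. Qed.

Lemma row_mx_neq0 x y : (x != 0) || (y != 0) -> row_mx x y != 0.
Proof. by rewrite -row_mx0; apply: contraTneq => /eq_row_mx[-> ->]; rewrite eqxx. Qed.

Lemma mul_scalar_block (a b c : R) x y :
  row_mx x y *m block_mx a%:M b%:M b%:M c%:M =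
  row_mx (a *: x + b *: y) (b *: x + c *: y).
Proof. by rewrite mul_row_block !mul_mx_scalar. Qed.

Lemma tr_scalar_block (a b c : R) :
  (block_mx a%:M b%:M b%:M c%:M : 'M[R]_(n + n))^T = block_mx a%:M b%:M b%:M c%:M.
Proof. by rewrite tr_block_mx !tr_scalar_mx. Qed.

Lemma qform_scalar_block (a b c : R) x y :
  qform (block_mx a%:M b%:M b%:M c%:M) (row_mx x y) =
  a * dot x x + 2 * b * dot x y + c * dot y y.
Proof.
by rewrite qformE mul_scalar_block dot_row_mx !dot_lin (dotC y x); ring.
Qed.

(** The Jacobian depends on the base point only through its first half [x0], and every test vector
    splits into halves [x], [y]. *)
Lemma ContR_driftP U gamma M rho : smooth U ->
  ContR (drift U gamma) M rho <->
  forall x0 x y,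
    dot (row_mx x y *m M) (row_mx y (- (x *m hess U x0) - gamma *: y)) <=
    - rho * qform M (row_mx x y).
Proof.
move=> sU.
have E z x y : qform (M *m jac (drift U gamma) z) (row_mx x y) =
    dot (row_mx x y *m M) (row_mx y (- (x *m hess U (lsubmx z)) - gamma *: y)).
  by rewrite -mul_jac_drift// /qform /dot trmx_mul trmxK !mulmxA.
have Z u : qform (- rho *: M) u = - rho * qform M u.
  by rewrite !qformE -scalemxAr dotZl.
split=> [C x0 x y|C z u]; last by rewrite -(hsubmxK u) E Z.
by have := C (row_mx x0 0) (row_mx x y); rewrite E Z row_mxKl.
Qed.

(** On an eigenvector of the Jacobian for a real [mu], contraction reads [mu <= - rho] after
    division by [qform M u > 0]. Such a [mu] exists when [k < gamma ^+ 2 / 4]; otherwise the second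
    term of the minimum suffices. *)
Lemma ContR_eigenvalue_ge U gamma M rho x0 k v :
  smooth U -> 0 < rho -> sym_posdef M -> ContR (drift U gamma) M rho ->
  v != 0 -> v *m hess U x0 = k *: v -> Num.min (rho ^+ 2) (gamma ^+ 2 / 4) <= k.
Proof.
move=> sU rho0 [_ M0] /(ContR_driftP _ _ _ sU) C v0 vk; rewrite ge_min.
have [//|kg] := leP (gamma ^+ 2 / 4) k; first by rewrite orbT.
rewrite orbF; pose s := Num.sqrt (gamma ^+ 2 - 4 * k).
have s0 : 0 <= s by exact: sqrtr_ge0.
have s2 : s ^+ 2 = gamma ^+ 2 - 4 * k by rewrite sqr_sqrtr//; lra.
(* The larger root of [mu ^ 2 + gamma mu + k], an eigenvalue of the Jacobian. *)
pose mu := (s - gamma) / 2.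
have muE : - k - gamma * mu = mu * mu by rewrite /mu; lra.
pose u := row_mx v (mu *: v).
have uu : row_mx (mu *: v) (- (v *m hess U x0) - gamma *: (mu *: v)) = mu *: u.
  by rewrite scale_row_mx vk !scalerA -scaleNr -scalerBl muE.
have := C x0 v (mu *: v); rewrite uu dotZr -/u -qformE ler_pM2r; last first.
  by apply: M0; rewrite row_mx_neq0// v0.
rewrite /mu => mur.
(* From [s <= gamma - 2 * rho] follows [4 * k = gamma ^+ 2 - s ^+ 2 >= 4 * rho * (gamma - rho)], and
   [gamma >= 2 * rho]. *)
by have : 0 <= gamma - 2 * rho - s; [lra|nra].
Qed.

(* Test the form on [(v, l v)] where the Hessian is [l ^ 2] and on [(v, - L v)]
   where it is [L ^ 2]; the coefficients of [M] on the plane they span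
   cancel out of the sum. *)
Lemma ContR_two_hessians U gamma M rho x x' (l L : R) : (0 < n)%N ->
  smooth U -> 0 < rho -> sym_posdef M -> ContR (drift U gamma) M rho ->
  0 < l -> 0 < L -> hess U x = (l ^+ 2)%:M -> hess U x' = (L ^+ 2)%:M ->
  L - l < gamma.
Proof.
move=> /(@exists_rV_neq0 R)[v v0] sU rho0 [sM M0] /(ContR_driftP _ _ _ sU) C l0 L0 hl hL.
pose e := row_mx v (0 : 'rV[R]_n); pose f := row_mx (0 : 'rV[R]_n) v.
have lin (s t : R) : row_mx (s *: v) (t *: v) = s *: e + t *: f.
  by rewrite /e /f !scale_row_mx add_row_mx !scaler0 addr0 add0r.
(* Contraction tested on [(v, t v)], written with the three coefficients of [M] on the plane of [e]
   and [f]; strict because [rho] and [M] are positive. *)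
have key z k t : hess U z = k%:M ->
    t * dot (e *m M) e + (t ^+ 2 - k - gamma * t) * dot (e *m M) f
      - t * (k + gamma * t) * dot (f *m M) f < 0.
  move=> hz; have := C z v (t *: v).
  rewrite hz mul_mx_scalar scalerA -scaleNr -scalerBl.
  rewrite -[X in row_mx X]scale1r => /le_lt_trans H.
  have : - rho * qform M (row_mx (1 *: v) (t *: v)) < 0.
    by rewrite mulNr oppr_lt0 mulr_gt0// M0// row_mx_neq0// scale1r v0.
  move=> /H; rewrite !lin scale1r mulmxDl -scalemxAl !dot_lin (dot_sym f e sM).
  by congr (_ < 0); ring.
have c0 : 0 < dot (f *m M) f by rewrite -qformE M0// row_mx_neq0// v0 orbT.
have := key _ _ l hl; have := key _ _ (- L) hL.
set a := dot _ e; set b := dot _ f; set c := dot _ f in c0 *.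
move=> H1 H2.
(* In both tests [t ^+ 2 = k], so [t] factors out; dividing by [- L < 0] in the other test reverses
   the sign. *)
have {}H2 : a - gamma * b - l ^+ 2 * c - gamma * l * c < 0.
  by rewrite -(pmulr_rlt0 _ l0); apply: le_lt_trans H2; lra.
have {}H1 : 0 < a - gamma * b - L ^+ 2 * c + gamma * L * c.
  by rewrite -(pmulr_rgt0 _ L0); rewrite -oppr_lt0; apply: le_lt_trans H1; lra.
have : 0 < c * (L + l) * (gamma - (L - l)) by lra.
by rewrite pmulr_rgt0 ?subr_gt0// mulr_gt0// addr_gt0.
Qed.

(* With [M = ((l L + gamma^2 / 2, gamma / 2), (gamma / 2, 1))] the form is
   [y . (l L - K) x - gamma / 2 * (x . K x + |y|^2)], and [l ^ 2 <= K <= L ^ 2]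
   gives [|(l L - K) x|^2 <= (L - l)^2 x . K x]. *)
Lemma ContR_of_pinched_hessian U gamma (l L : R) : (0 < n)%N ->
  smooth U -> 0 < gamma -> 0 < l -> 0 < L -> L - l < gamma ->
  (forall x, (l ^+ 2)%:M <=L hess U x /\ hess U x <=L (L ^+ 2)%:M) ->
  exists rho M, [/\ 0 < rho, sym_posdef M & ContR (drift U gamma) M rho].
Proof.
move=> n0 sU g0 l0 L0 Ll hU.
have l2 : 0 < l ^+ 2 by rewrite exprn_gt0.
have lL : l <= L.
  have [h1 h2] := hU 0; have := scalar_loewner_le n0 h1 h2.
  by rewrite ler_pXn2r// nnegrE ltW.
have lL0 : 0 < l * L by rewrite mulr_gt0.
(* The midpoint of [L - l] and [gamma]: positive even if [L = l], and still below [gamma]. *)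
pose d := (L - l + gamma) / 2.
have [d0 dg dL] : [/\ 0 < d, d < gamma & L - l <= d] by rewrite /d; split; lra.
pose a := l * L + gamma ^+ 2 / 2.
pose M : 'M[R]_(n + n) := block_mx a%:M (gamma / 2)%:M (gamma / 2)%:M 1%:M.
have a0 : 0 < a by rewrite /a addr_gt0// divr_gt0// exprn_gt0.
(* Chosen so that [qform M (row_mx x y) <= B * (l ^+ 2 * |x|^2 + |y|^2)], which is [MB] below; [rho]
   is the decay rate [(gamma - d) / 2] divided by [B]. *)
pose B := (a + gamma ^+ 2 / 2) / l ^+ 2 + 2.
have B0 : 0 < B.
  by rewrite /B addr_gt0// divr_gt0// addr_gt0// divr_gt0// exprn_gt0.
pose rho := (gamma - d) / 2 / B.
have rho0 : 0 < rho by rewrite !divr_gt0// subr_gt0.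
exists rho, M; split=> //.
  split; first exact: tr_scalar_block.
  move=> u; rewrite -(hsubmxK u); set x := lsubmx u; set y := rsubmx u => u0.
  have -> : qform M (row_mx x y) = dot (y + (gamma / 2) *: x) (y + (gamma / 2) *: x)
      + (l * L + gamma ^+ 2 / 4) * dot x x.
    by rewrite qform_scalar_block /a !dot_lin (dotC y x); field.
  have c0 : 0 < l * L + gamma ^+ 2 / 4 by rewrite addr_gt0// divr_gt0// exprn_gt0.
  have [x0|x0] := eqVneq x 0.
    rewrite x0 scaler0 addr0 dot0r mulr0 addr0 dot_gt0.
    by apply: contra_neq u0 => y0; rewrite x0 y0 row_mx0.
  by rewrite ltr_wpDl ?dot_ge0// mulr_gt0// dot_gt0.
apply/(ContR_driftP _ _ _ sU) => x0 x y; set K := hess U x0.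
have [Kl KL] := hU x0.
have ll : l ^+ 2 <= L ^+ 2 by apply: scalar_loewner_le Kl KL.
have N := sqr_mulmx_le_interval x (hess_sym x0 sU) ll Kl KL.
have P := Kl x; rewrite qform_scalar qformE in P.
have X0 := dot_ge0 x; have Y0 := dot_ge0 y.
(* With [N] this square gives the Young inequality [W3]; the square [V] below bounds the cross term
   of [M] in [MB]. *)
have W := dot_ge0 ((l * L) *: x - x *m K - d *: y).
have V := dot_ge0 (gamma *: x - y).
rewrite qform_scalar_block mul_scalar_block dot_row_mx.
rewrite !dot_lin in W V *.
rewrite -/K ?(dotC x (x *m K)) ?(dotC y (x *m K)) ?(dotC y x) in N P W V *.
set X := dot x x in N P X0 W V *; set Y := dot y y in Y0 W V *.
set C := dot x y in W V *; set Q := dot (x *m K) y in W *.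
set PP := dot (x *m K) x in N P W *; set NN := dot (x *m K) (x *m K) in N W *.
have P0 : 0 <= PP by apply: le_trans P; rewrite mulr_ge0// ltW.
have W1 : 0 <= (L - l) ^+ 2 * PP - 2 * d * (l * L * C - Q) + d ^+ 2 * Y.
  by apply: le_trans W _; lra.
have W2 : (L - l) ^+ 2 * PP <= d ^+ 2 * PP.
  by rewrite ler_wpM2r// ler_pXn2r// nnegrE; lra.
have W3 : 2 * (l * L * C - Q) <= d * (PP + Y).
  by rewrite -(ler_pM2l d0); lra.
(* By [W3] the form is at most [- (gamma - d) / 2 * (PP + Y)]; it remains to pass from [PP] to
   [l ^+ 2 * X] and then to [qform M]. *)
have D : (gamma - d) / 2 * (l ^+ 2 * X + Y) <= (gamma - d) / 2 * (PP + Y).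
  by apply: ler_wpM2l; lra.
have MB : a * X + gamma * C + Y <= B * (l ^+ 2 * X + Y).
  have -> : B * (l ^+ 2 * X + Y) = (a + gamma ^+ 2 / 2) * X + 2 * l ^+ 2 * X
      + 2 * Y + (a + gamma ^+ 2 / 2) / l ^+ 2 * Y.
    by rewrite /B; field; rewrite gt_eqF.
  have T1 : 0 <= (a + gamma ^+ 2 / 2) / l ^+ 2 * Y.
    by rewrite mulr_ge0// divr_ge0// ltW// addr_gt0// divr_gt0// exprn_gt0.
  have T2 : 0 <= l ^+ 2 * X by rewrite mulr_ge0// ltW.
  lra.
have R1 : rho * (a * X + gamma * C + Y) <= (gamma - d) / 2 * (l ^+ 2 * X + Y).
  rewrite (_ : (gamma - d) / 2 = rho * B); last by rewrite /rho divfK// gt_eqF.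
  by rewrite -mulrA ler_wpM2l// ltW.
rewrite mulNr lerNr; apply: le_trans (le_trans _ (le_trans R1 D)) _.
  by rewrite (_ : _ + _ + _ = a * X + gamma * C + Y)//; field.
rewrite /a; lra.
Qed.

End DriftForm.

(** * The explicit matrix for [Lambda <= gamma ^+ 2 / 4] *)

Section ExplicitMatrix.
Variables (R : realType) (n : nat) (gamma Lambda : R).
Hypotheses (gamma_gt0 : 0 < gamma) (Lambda_gt0 : 0 < Lambda)
  (Lambda_le : Lambda <= gamma ^+ 2 / 4).

Let M : 'M[R]_(n + n) :=
  block_mx 1%:M (gamma^-1)%:M (gamma^-1)%:M (Lambda^-1)%:M.

Let qformM (x y : 'rV[R]_n) : qform M (row_mx x y) =
  dot x x + 2 * gamma^-1 * dot x y + Lambda^-1 * dot y y.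
Proof. by rewrite qform_scalar_block mul1r. Qed.

Let sqr_invg_le : 4 * gamma^-1 ^+ 2 <= Lambda^-1.
Proof.
rewrite -(ler_pM2r Lambda_gt0) mulVf ?gt_eqF// exprVn mulrAC.
by rewrite ler_pdivrMr ?exprn_gt0// mul1r; move: Lambda_le; lra.
Qed.

(** The squares of [x - 2 y / gamma] and [x + 2 y / gamma] bound the cross term by half of
    [|x|^2 + 4 |y|^2 / gamma^2], and [4 / gamma^2 <= 1 / Lambda]. *)
Let qform_diag (x y : 'rV[R]_n) :
  2^-1 * (dot x x + Lambda^-1 * dot y y) <= qform M (row_mx x y) <=
  3 / 2 * (dot x x + Lambda^-1 * dot y y).
Proof.
have Y := dot_ge0 y.
have H1 := dot_ge0 (x - (2 * gamma^-1) *: y).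
have H2 := dot_ge0 (x + (2 * gamma^-1) *: y).
rewrite !dot_lin (dotC y x) in H1 H2.
have H3 := ler_wpM2r Y sqr_invg_le.
by rewrite qformM; apply/andP; split; lra.
Qed.

Let dot_hsub (u : 'rV[R]_(n + n)) :
  dot u u = dot (lsubmx u) (lsubmx u) + dot (rsubmx u) (rsubmx u).
Proof. by rewrite -dot_row_mx hsubmxK. Qed.

Lemma explicit_qform_ge : (2^-1 * Num.min 1 Lambda^-1)%:M <=L M.
Proof.
move=> u; rewrite -[u in qform M u]hsubmxK qform_scalar -mulrA dot_hsub.
have /andP[+ _] := qform_diag (lsubmx u) (rsubmx u); apply: le_trans.
rewrite ler_pM2l ?invr_gt0// mulrDr lerD ?ler_wpM2r ?dot_ge0 ?ge_min ?lexx ?orbT//.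
by rewrite -[leRHS]mul1r ler_wpM2r ?dot_ge0// ge_min lexx.
Qed.

Lemma explicit_qform_le : M <=L (3 / 2 * Num.max 1 Lambda^-1)%:M.
Proof.
move=> u; rewrite -[u in qform M u]hsubmxK qform_scalar -[_ * _ * dot u u]mulrA dot_hsub.
have /andP[_ h] := qform_diag (lsubmx u) (rsubmx u); apply: le_trans h _.
rewrite ler_pM2l ?divr_gt0// mulrDr lerD ?ler_wpM2r ?dot_ge0 ?le_max ?lexx ?orbT//.
by rewrite -[leLHS]mul1r ler_wpM2r ?dot_ge0// le_max lexx.
Qed.

Lemma explicit_sym_posdef : sym_posdef M.
Proof.
split; first exact: tr_scalar_block.
move=> u; rewrite -dot_gt0 => u0.
have := explicit_qform_ge u; rewrite qform_scalar; apply: lt_le_trans.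
by rewrite !mulr_gt0// ?invr_gt0// lt_min ltr01 invr_gt0.
Qed.

(** The off-diagonal [gamma^-1] cancels the [x . y] terms of the drift form. The difference of the
    two sides is then [gamma^-1] times the left side of [E], to be shown nonpositive. *)
Lemma explicit_ContR U (lambda : R) : (0 < n)%N -> smooth U -> 0 < lambda ->
  (forall x, lambda%:M <=L hess U x /\ hess U x <=L Lambda%:M) ->
  ContR (drift U gamma) M (lambda / (3 * gamma)).
Proof.
move=> n0 sU lam0 hU; apply/(ContR_driftP _ _ _ sU) => x0 x y.
have [Kl KL] := hU x0; set K := hess U x0 in Kl KL *.
have lamL : lambda <= Lambda by apply: scalar_loewner_le Kl KL.
have K0 : 0%:M <=L K.
  move=> u; apply: le_trans (Kl u); rewrite !qform_scalar mul0r.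
  by rewrite mulr_ge0 ?dot_ge0// ltW.
(* The interval is taken from [0], which gives [|K x|^2 <= Lambda * (x . K x)]. *)
have N := sqr_mulmx_le_interval x (hess_sym x0 sU) (ltW Lambda_gt0) K0 KL.
rewrite mul0r mul0r subr0 add0r in N.
have P := Kl x; rewrite qform_scalar qformE in P.
have X0 := dot_ge0 x; have Y0 := dot_ge0 y.
have W1 := dot_ge0 (x *m K + gamma *: y).
have W2 := dot_ge0 (x - (2 * gamma^-1) *: y).
rewrite qformM mul_scalar_block dot_row_mx.
rewrite !dot_lin in W1 W2 *.
rewrite -/K ?(dotC x (x *m K)) ?(dotC y (x *m K)) ?(dotC y x) in N P W1 W2 *.
set X := dot x x in P X0 W2 *; set Y := dot y y in Y0 W1 W2 *.
set C := dot x y in W2 *; set Q := dot (x *m K) y in W1 *.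
set PP := dot (x *m K) x in N P *; set NN := dot (x *m K) (x *m K) in N W1.
pose i := gamma^-1; pose j := Lambda^-1.
have ig : i * gamma = 1 by rewrite mulVf ?gt_eqF.
have jL : j * Lambda = 1 by rewrite mulVf ?gt_eqF.
have i0 : 0 < i by rewrite invr_gt0.
have j0 : 0 < j by rewrite invr_gt0.
have h1 : j * NN <= PP.
  by rewrite -[PP]mul1r -jL -mulrA ler_wpM2l// ltW.
have h2 : 0 <= j * (NN + 2 * gamma * Q + gamma ^+ 2 * Y).
  by rewrite mulr_ge0 ?(ltW j0)//; apply: le_trans W1 _; lra.
have h3 : 0 <= lambda * (X - 4 * i * C + 4 * i ^+ 2 * Y).
  by rewrite mulr_ge0 ?(ltW lam0)//; apply: le_trans W2 _; rewrite -/i; lra.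
have h4 : lambda * j * Y <= Y.
  by rewrite -[leRHS]mul1r ler_wpM2r// -jL mulrC ler_wpM2l// ltW.
have h5 : 4 * (lambda * i ^+ 2 * Y) <= lambda * j * Y.
  have := ler_wpM2l (mulr_ge0 (ltW lam0) Y0) sqr_invg_le; rewrite -/i -/j; lra.
have h6 : 4 * Y <= j * gamma ^+ 2 * Y.
  rewrite ler_wpM2r// -(ler_pM2l Lambda_gt0) mulrA (mulrC Lambda j) jL mul1r.
  by move: Lambda_le; lra.
(* Half of [PP] absorbs the [Q] term by [h1] and [h2]; the other half gives [lambda / 2 * X], which
   exactly pays for [lambda / 3 * X] and the [lambda / 6 * X] from the cross term. Hence the factor
   3 in the rate. *)
have E : (Y - PP) - j * gamma * Q - j * gamma ^+ 2 * Y
    + lambda / 3 * (X + 2 * i * C + j * Y) <= 0 by lra.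
have iE := ler_wpM2l (ltW i0) E; rewrite mulr0 in iE.
rewrite -subr_le0; apply: le_trans iE; rewrite -/i -/j.
rewrite le_eqVlt; apply/orP; left; apply/eqP; rewrite /i; field.
by rewrite gt_eqF.
Qed.

End ExplicitMatrix.

Theorem proposition4 (R : realType) (n : nat) (U : 'rV[R]_n -> R) (gamma : R)
  (n_ge1 : (1 <= n)%N) (U_smooth : smooth U) (gamma_gt0 : 0 < gamma) :
  [/\ (* 1 *)
      (exists (rho : R) (M : 'M[R]_(n + n)),
         [/\ 0 < rho, sym_posdef M & ContR (drift U gamma) M rho]) ->
      exists2 lambda : R, 0 < lambda & forall x, lambda%:M <=L hess U x,
      (* 2 *)
      (exists (x x' : 'rV[R]_n) (lambda Lambda : R),
         [/\ 0 < lambda, 0 < Lambda,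
             gamma <= Num.sqrt Lambda - Num.sqrt lambda,
             hess U x = lambda%:M & hess U x' = Lambda%:M]) ->
      forall (rho : R) (M : 'M[R]_(n + n)), 0 < rho -> sym_posdef M ->
        ~ ContR (drift U gamma) M rho,
      (* 3 *)
      (exists lambda Lambda : R,
         [/\ 0 < lambda, 0 < Lambda,
             Num.sqrt Lambda - Num.sqrt lambda < gamma &
             forall x, lambda%:M <=L hess U x /\ hess U x <=L Lambda%:M]) ->
      exists (rho : R) (M : 'M[R]_(n + n)),
        [/\ 0 < rho, sym_posdef M & ContR (drift U gamma) M rho] &
      (* 4 *)
      forall lambda Lambda : R, 0 < lambda -> 0 < Lambda ->
        Lambda <= gamma ^+ 2 / 4 ->
        (forall x, lambda%:M <=L hess U x /\ hess U x <=L Lambda%:M) ->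
        let rho : R := lambda / (3 * gamma) in
        let M : 'M[R]_(n + n) :=
          block_mx 1%:M (gamma^-1)%:M (gamma^-1)%:M (Lambda^-1)%:M in
        [/\ sym_posdef M,
            ContR (drift U gamma) M rho,
            (2^-1 * Num.min 1 Lambda^-1)%:M <=L M &
            M <=L (3 / 2 * Num.max 1 Lambda^-1)%:M]].
Proof.
split.
- move=> [rho [M [rho0 M0 C]]]; exists (Num.min (rho ^+ 2) (gamma ^+ 2 / 4)).
    by rewrite lt_min exprn_gt0// divr_gt0// exprn_gt0.
  (* The smallest eigenvalue at each [x] is bounded below by a constant independent of [x]. *)
  move=> x; have [k [v [v0 vk kK]]] := min_eigenvector n_ge1 (hess_sym x U_smooth).
  have mk := ContR_eigenvalue_ge U_smooth rho0 M0 C v0 vk.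
  move=> u; apply: le_trans (kK u); rewrite !qform_scalar.
  by rewrite ler_wpM2r// dot_ge0.
- move=> [x [x' [lambda [Lambda [lam0 Lam0 gle hx hx']]]]] rho M rho0 M0 C.
  move: gle; apply/negP; rewrite -ltNge.
  (* Here [l] and [L] are the square roots of [lambda] and [Lambda]. *)
  apply: (ContR_two_hessians (x := x) (x' := x') n_ge1 U_smooth rho0 M0 C);
    rewrite ?sqrtr_gt0 ?sqr_sqrtr ?ltW//.
- move=> [lambda [Lambda [lam0 Lam0 gle hU]]].
  apply: (ContR_of_pinched_hessian n_ge1 U_smooth gamma_gt0 _ _ gle);
    rewrite ?sqrtr_gt0// !sqr_sqrtr ?ltW//.
- move=> lambda Lambda lam0 Lam0 Lle hU rho M; split.
  + exact: explicit_sym_posdef.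
  + exact: explicit_ContR.
  + exact: explicit_qform_ge.
  + exact: explicit_qform_le.
Qed.
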